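(* Let $G=([n],E)$ be an undirected graph. The normals of all clique inequalities lie in $\mathcal{A}_G^{(2)}$; that is, for every clique $K$ in $G$ with at least two vertices, $\mathbf{e}(K) \in \mathcal{A}_G^{(2)}$.
   Context: Graphs are simple. $\mathbf{e}_i$ is the $i$th standard unit vector of $\mathbb{R}^n$; for a clique $K$ (a set of pairwise adjacent vertices), $\mathbf{e}(K) = \sum_{i \in K} \mathbf{e}_i$ is the normal of the clique inequality $\sum_{i \in K} x_i \leq 1$. Let $\mathcal{A}_G := \{\mathbf{e}_i + \mathbf{e}_j : \{i,j\} \in E\} \cup \{-\mathbf{e}_i : i \in [n]\}$. A basis in a set of vectors of $\mathbb{Z}^n$ is a subset of $n$ linearly independent vectors, and the cone generated by it is a basis cone. The minimal Hilbert basis of a pointed rational cone is the unique minimal finite set of its integer points such that every integer point of the cone is a nonnegative integer combination of elements of the set. Set $\mathcal{A}_G^{(0)} = \mathcal{A}_G$, and for $k \geq 1$ let $\mathcal{A}_G^{(k)}$ be the union of the minimal Hilbert bases of all basis cones of $\mathcal{A}_G^{(k-1)}$. *)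

(* Defs.v *)
From HB Require Import structures.
From mathcomp Require Import all_boot all_order all_algebra.
From mathcomp Require Import finmap classical_sets reals.

Set Implicit Arguments.
Unset Strict Implicit.
Unset Printing Implicit Defensive.

Import Order.TTheory GRing.Theory Num.Theory.
Local Open Scope ring_scope.
Local Open Scope classical_set_scope.

Definition simple_graph (n : nat) (E : rel 'I_n) : Prop :=
  symmetric E /\ irreflexive E.

Definition clique (n : nat) (E : rel 'I_n) (K : {set 'I_n}) : Prop :=
  {in K &, forall i j : 'I_n, i != j -> E i j}.

Definition unit_vec (n : nat) (i : 'I_n) : 'rV[int]_n := delta_mx 0 i.

Definition clique_normal (n : nat) (K : {set 'I_n}) : 'rV[int]_n :=
  \sum_(i in K) unit_vec i.

Definition graph_vectors (n : nat) (E : rel 'I_n) : set 'rV[int]_n :=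
  [set v | (exists i j : 'I_n, E i j /\ v = unit_vec i + unit_vec j)
        \/ (exists i : 'I_n, v = - unit_vec i)].

Definition to_real (R : realType) (n : nat) (v : 'rV[int]_n) : 'rV[R]_n :=
  map_mx intr v.

Definition basis_in (R : realType) (n : nat) (A : set 'rV[int]_n)
    (S : {fset 'rV[int]_n}) : Prop :=
  [/\ forall v, v \in S -> A v,
      #|` S| = n &
      free [seq to_real R v | v <- S]].

Definition cone (R : realType) (n : nat) (S : {fset 'rV[int]_n}) :
    set 'rV[R]_n :=
  [set x | exists2 c : 'rV[int]_n -> R,
     (forall v, 0 <= c v) & x = \sum_(v <- S) c v *: to_real R v].

Definition hilbert_basis (R : realType) (n : nat) (C : set 'rV[R]_n)
    (H : {fset 'rV[int]_n}) : Prop :=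
  (forall h, h \in H -> C (to_real R h)) /\
  (forall z : 'rV[int]_n, C (to_real R z) ->
     exists c : 'rV[int]_n -> nat, z = \sum_(h <- H) h *+ c h).

(* Minimality is with respect to inclusion; on a pointed rational cone, such as
   a basis cone, there is exactly one such H. *)
Definition minimal_hilbert_basis (R : realType) (n : nat) (C : set 'rV[R]_n)
    (H : {fset 'rV[int]_n}) : Prop :=
  hilbert_basis C H /\
  (forall H' : {fset 'rV[int]_n},
     hilbert_basis C H' -> fsubset H' H -> H' = H).

Definition hilbert_step (R : realType) (n : nat) (A : set 'rV[int]_n) :
    set 'rV[int]_n :=
  [set v | exists S H : {fset 'rV[int]_n},
     [/\ basis_in R A S, minimal_hilbert_basis (@cone R n S) H & v \in H]].

Definition hilbert_closure (R : realType) (n : nat) (E : rel 'I_n) (k : nat) :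
    set 'rV[int]_n :=
  iter k (@hilbert_step R n) (graph_vectors E).

(* Main.v *)
Require Import Defs.
From HB Require Import structures.
From mathcomp Require Import all_boot all_order all_algebra.
From mathcomp Require Import finmap boolp classical_sets reals.
From mathcomp Require Import lra zify.

Set Implicit Arguments.
Unset Strict Implicit.
Unset Printing Implicit Defensive.

Import Order.TTheory GRing.Theory Num.Theory.
Local Open Scope ring_scope.
Local Open Scope classical_set_scope.

(** Two facts make membership in the set of Hilbert basis elements easy to
    test. A finitely generated cone has a finite Hilbert basis, hence a minimal
    one ([hilbert_basis_exists], [minimal_hilbert_basis_exists]); and a nonzero
    integer point of the cone that is not the sum of two nonzero integer points
    of the cone belongs to every Hilbert basis
    ([irreducible_in_hilbert_basis]).

    All the irreducible points needed here are of the shape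
    v = (1/m) sum_(i in J) g i, where g is a basis and J a set of indices. If
    v = z1 + z2 inside the cone, the coefficients of z1 vanish outside J and lie
    in [0, 1/m] on J. Suppose that integrality of z1 forces them to be all
    equal. Then z1 is a multiple t v with t in [0, 1], and if v has a coordinate
    1 or -1, t is an integer, so z1 = 0 or z1 = v. This is
    [hilbert_step_equal_coefficients].

    Let K be a clique with k elements, and complete families indexed by K with
    the vectors - e_j, for j outside K.
    - If k is odd and at least 3, the edges of a Hamiltonian cycle of K are
      independent and half their sum is e(K). Consecutive coefficients c, c' of
      an integer point lie in [0, 1/2] and c + c' is an integer, so c = c'.
      Hence one step produces e(K) ([hilbert_step_odd_clique]).
    - If k is at least 3, the vectors e(K \ i), for i in K, are independent and
      sum to (k - 1) e(K). The coefficients of an integer point differ by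
      integers and lie in [0, 1/(k - 1)], so they are equal. Hence one step from
      the e(K \ i) produces e(K) ([hilbert_step_delete_vertex]).
    For k even and at least 4 the first item applies to the K \ i and the second
    one gives e(K) in a second step. The vectors - e_i and e(K) are never lost
    ([hilbert_step_negative], [hilbert_step_clique_normal]), which settles the
    odd cliques, produced one step early, and the edges. *)

(** * Integer vectors in real space *)

Lemma to_realE (R : realType) (n : nat) (v : 'rV[int]_n) i j :
  to_real R v i j = (v i j)%:~R.
Proof. by rewrite mxE. Qed.

Lemma to_realD (R : realType) (n : nat) (u v : 'rV[int]_n) :
  to_real R (u + v) = to_real R u + to_real R v.
Proof. exact: map_mxD. Qed.

Lemma to_real0 (R : realType) (n : nat) : to_real R (0 : 'rV[int]_n) = 0.
Proof. exact: map_mx0. Qed.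

Lemma to_realMn (R : realType) (n : nat) (v : 'rV[int]_n) k :
  to_real R (v *+ k) = k%:R *: to_real R v.
Proof. by apply/rowP=> j; rewrite !mxE mulmxnE rmorphMn /= mulr_natl. Qed.

Lemma to_real_sum (R : realType) (n : nat) (I : Type) (r : seq I) (P : pred I)
    (F : I -> 'rV[int]_n) :
  to_real R (\sum_(i <- r | P i) F i) = \sum_(i <- r | P i) to_real R (F i).
Proof. by elim/big_rec2: _ => [|i ? ? _ <-]; rewrite ?to_real0 ?to_realD. Qed.

Lemma to_real_inj (R : realType) (n : nat) : injective (@to_real R n).
Proof.
move=> u v /rowP uv; apply/rowP => j; apply: (@intr_inj R).
by have := uv j; rewrite !mxE.
Qed.

(** * Cones and their Hilbert bases *)

Lemma cone0 (R : realType) (n : nat) (S : {fset 'rV[int]_n}) :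
  cone S (0 : 'rV[R]_n).
Proof. by exists (fun=> 0) => //; rewrite big1 // => v _; rewrite scale0r. Qed.

Lemma coneD (R : realType) (n : nat) (S : {fset 'rV[int]_n}) (x y : 'rV[R]_n) :
  cone S x -> cone S y -> cone S (x + y).
Proof.
move=> [c c0 ->] [d d0 ->]; exists (fun v => c v + d v) => [v|].
  exact: addr_ge0.
by rewrite -big_split; apply: eq_bigr => v _; rewrite scalerDl.
Qed.

Lemma cone_sum (R : realType) (n : nat) (S : {fset 'rV[int]_n})
    (I : Type) (r : seq I) (P : pred I) (F : I -> 'rV[R]_n) :
  (forall i, P i -> cone S (F i)) -> cone S (\sum_(i <- r | P i) F i).
Proof. by move=> CF; apply: big_ind => //; [exact: cone0 | exact: coneD]. Qed.

Lemma cone_muln (R : realType) (n : nat) (S : {fset 'rV[int]_n})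
    (x : 'rV[R]_n) k :
  cone S x -> cone S (x *+ k).
Proof.
move=> Cx; elim: k => [|k IH]; first exact: cone0.
by rewrite mulrS; exact: coneD.
Qed.

Lemma cone_gen (R : realType) (n : nat) (S : {fset 'rV[int]_n}) v :
  v \in S -> cone S (to_real R v).
Proof.
move=> vS; exists (fun w => (w == v)%:R) => [w|]; first exact: ler0n.
rewrite (bigD1_seq v) ?fset_uniq //= eqxx scale1r big1 ?addr0 // => w /negbTE->.
by rewrite scale0r.
Qed.

Lemma box_finite (n B : nat) :
  exists X : {fset 'rV[int]_n},
    forall v : 'rV[int]_n, (forall j, `|v 0 j| <= B%:Z) -> v \in X.
Proof.
exists [fset v in [seq \row_j ((f j : 'I_(B.*2.+1))%:Z - B%:Z)
                  | f : {ffun 'I_n -> 'I_(B.*2.+1)}]]%fset.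
move=> v vB; rewrite inE; apply/codomP.
exists [ffun j => inord `|(v 0 j + B%:Z)%R|%N].
apply/rowP => j; rewrite mxE ffunE; have := vB j.
rewrite ler_norml => /andP[lo hi].
have ge0 : 0 <= v 0 j + B%:Z by lra.
rewrite inordK; first by rewrite gez0_abs //; lra.
have szE : (B.*2.+1)%:Z = B%:Z + B%:Z + 1 by rewrite -addn1 -addnn !PoszD.
rewrite -ltz_nat gez0_abs // szE; lra.
Qed.

(** Gordan's lemma. Rounding down the coefficients of an integer point of the
    cone leaves an integer point of the parallelepiped spanned by the
    generators; the integer points of the cone inside a box that contains this
    parallelepiped are therefore a Hilbert basis. *)
Lemma hilbert_basis_exists (R : realType) (n : nat) (S : {fset 'rV[int]_n}) :
  exists H : {fset 'rV[int]_n}, hilbert_basis (@cone R n S) H.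
Proof.
(* The sum of the sizes of all coordinates of the generators bounds every
   coordinate of a point of the parallelepiped. *)
pose B := (\sum_(v <- S) \sum_j `|v 0%R j|)%N.
have [X in_box] := box_finite n B.
pose H := [fset z in X | `[< @cone R n S (to_real R z) >]]%fset.
have HC h : h \in H -> cone S (to_real R h).
  by rewrite !inE => /andP[_ /asboolP].
exists H; split=> // z [c c0 zE].
pose spans u := exists d : 'rV[int]_n -> nat, u = \sum_(h <- H) h *+ d h.
have spans0 : spans 0 by exists (fun=> 0%N); rewrite big1.
have spansD u w : spans u -> spans w -> spans (u + w).
  move=> [d ->] [e ->]; exists (fun h => d h + e h)%N.
  by rewrite -big_split; apply: eq_bigr => h _; rewrite mulrnDr.
have spansH h : h \in H -> spans h.
  move=> hH; exists (fun u => (u == h) : nat).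
  rewrite (bigD1_seq h) ?fset_uniq //= eqxx big1 ?addr0 // => w /negbTE->.
  by rewrite mulr0n.
have SH v : v \in S -> v \in H.
  move=> vS; rewrite !inE; apply/andP; split; last exact/asboolP/cone_gen.
  apply: in_box => j; rewrite -abszE lez_nat /B (bigD1_seq v) ?fset_uniq //=.
  by rewrite (bigD1 j) //= -addnA leq_addr.
pose a v := Num.trunc (c v).
pose f v := c v - (a v)%:R.
have f_ge0 v : 0 <= f v by rewrite subr_ge0 truncn_le.
have f_le1 v : f v <= 1.
  by have /andP[_ /ltW] := truncn_itv (c0 v); rewrite -natr1 /f => ?; lra.
pose r := z - \sum_(v <- S) v *+ a v.
have rE : to_real R r = \sum_(v <- S) f v *: to_real R v.
  apply: (addIr (to_real R (\sum_(v <- S) v *+ a v))).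
  rewrite -to_realD subrK zE to_real_sum -big_split; apply: eq_bigr => v _ /=.
  by rewrite to_realMn -scalerDl subrK.
have -> : z = \sum_(v <- S) v *+ a v + r by rewrite addrC subrK.
apply: (spansD).
  rewrite big_seq; apply: (big_ind spans spans0 spansD) => v /SH/spansH vs.
  by elim: (a v) => // k IH; rewrite mulrS; apply: spansD.
apply: spansH; rewrite !inE; apply/andP; split; last first.
  by apply/asboolP; exists f.
apply: in_box => j; rewrite -(ler_int R) intr_norm -to_realE rE summxE.
apply: le_trans (ler_norm_sum _ _ _) _; rewrite /B -pmulrn natr_sum.
apply: ler_sum => v _; rewrite !mxE normrM (ger0_norm (f_ge0 v)).
apply: le_trans (_ : `|(v 0 j)%:~R| <= _); first by rewrite ler_piMl.
by rewrite -intr_norm -abszE -pmulrn ler_nat (bigD1 j) //= leq_addr.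
Qed.

Lemma minimal_hilbert_basis_exists (R : realType) (n : nat) (C : set 'rV[R]_n)
    (H : {fset 'rV[int]_n}) :
  hilbert_basis C H -> exists H', minimal_hilbert_basis C H'.
Proof.
have [k] := ubnP #|` H|; elim: k H => // k IH H; rewrite ltnS => leHk hbH.
have [[H' [hbH' ltH']]|minH] :=
    pselect (exists H', hilbert_basis C H' /\ (H' `<` H)%fset).
  by apply: (IH H') => //; apply: leq_trans leHk; exact: fproper_ltn_card.
exists H; split=> // H' hbH' sub; apply/eqP; apply: contrapT => /negP neq.
by case: minH; exists H'; split; rewrite // fproperEneq neq.
Qed.

(** Write v as a combination of H and split off one element h that occurs: the
    remainder lies in the cone, so it vanishes and v = h. *)
Lemma irreducible_in_hilbert_basis (R : realType) (n : nat)
    (S H : {fset 'rV[int]_n}) (v : 'rV[int]_n) :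
  hilbert_basis (@cone R n S) H -> v != 0 -> cone S (to_real R v) ->
  (forall z1 z2, cone S (to_real R z1) -> cone S (to_real R z2) ->
     v = z1 + z2 -> z1 = 0 \/ z2 = 0) ->
  v \in H.
Proof.
move=> [HC Hgen] v0 /Hgen [c vE] irr.
have Cmul h k : h \in H -> cone S (to_real R (h *+ k)).
  by move=> hH; rewrite to_realMn scaler_nat; apply: cone_muln; exact: HC.
have [h /andP[hH ch0]] : exists h, (h \in H) && (h *+ c h != 0).
  apply: contrapT => no; case/eqP: v0; rewrite vE big_seq big1 // => h hH.
  by apply/eqP; apply: contrapT => /negP hc; apply: no; exists h; rewrite hH.
have [m cE] : exists m, c h = m.+1.
  by case: (c h) ch0 => [|m]; [rewrite mulr0n eqxx | exists m].
have h0 : h != 0 by apply: contraNneq ch0 => ->; rewrite mul0rn.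
move: vE; rewrite (bigD1_seq h) ?fset_uniq //= cE mulrS -addrA => vE.
case: (irr _ _ (HC h hH) _ vE) => [|/eqP|rest0]; last by rewrite vE rest0 addr0.
  rewrite to_realD to_real_sum; apply: coneD; first exact: Cmul.
  by rewrite big_seq_cond; apply: cone_sum => w /andP[wH _]; exact: Cmul.
by rewrite (negbTE h0).
Qed.

(** * Basis cones presented by families *)

(** Bases are handled as families indexed by coordinates, so that a basis made
    of one vector per vertex can be described vertex by vertex. *)
Definition independent_family (R : realType) (n : nat)
    (g : 'I_n -> 'rV[int]_n) : Prop :=
  forall d : 'I_n -> R,
    \sum_i d i *: to_real R (g i) = 0 -> forall i, d i = 0.

Definition family_fset (n : nat) (g : 'I_n -> 'rV[int]_n) :
    {fset 'rV[int]_n} :=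
  [fset v in codom g]%fset.

Lemma independent_free (R : realType) (n : nat) (g : 'I_n -> 'rV[int]_n) :
  independent_family R g -> free (codom (fun i => to_real R (g i))).
Proof.
move=> indep.
have -> : codom (fun i => to_real R (g i)) =
          [tuple to_real R (g i) | i < n] :> seq _ by [].
apply/freeP => d d0 i; apply: indep (i); rewrite -[RHS]d0.
by apply: eq_bigr => j _; rewrite -tnth_nth tnth_mktuple.
Qed.

Lemma independent_inj (R : realType) (n : nat) (g : 'I_n -> 'rV[int]_n) :
  independent_family R g -> injective g.
Proof.
move=> /independent_free/free_uniq/injectiveP gI i j gij.
by apply: gI; rewrite gij.
Qed.

Lemma family_fset_perm (R : realType) (n : nat) (g : 'I_n -> 'rV[int]_n) :
  independent_family R g -> perm_eq (family_fset g) (codom g).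
Proof.
move=> /independent_inj gI; apply: uniq_perm; first exact: fset_uniq.
  exact/injectiveP.
by move=> v; rewrite inE.
Qed.

Lemma basis_in_family (R : realType) (n : nat) (A : set 'rV[int]_n)
    (g : 'I_n -> 'rV[int]_n) :
  independent_family R g -> (forall i, A (g i)) ->
  basis_in R A (family_fset g).
Proof.
move=> indep Ag; have gperm := family_fset_perm indep; split.
- by move=> v; rewrite (perm_mem gperm) => /codomP[i ->].
- by rewrite (perm_size gperm) size_codom card_ord.
- rewrite (perm_free (perm_map (@to_real R n) gperm)) -map_comp.
  exact: independent_free.
Qed.

Lemma cone_family (R : realType) (n : nat) (g : 'I_n -> 'rV[int]_n)
    (x : 'rV[R]_n) :
  independent_family R g ->
  cone (family_fset g) x <->
  exists2 c : 'I_n -> R,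
    (forall i, 0 <= c i) & x = \sum_i c i *: to_real R (g i).
Proof.
move=> indep; have gI := independent_inj indep.
have sumE (c : 'rV[int]_n -> R) :
    \sum_(v <- family_fset g) c v *: to_real R v =
    \sum_i c (g i) *: to_real R (g i).
  by rewrite (perm_big _ (family_fset_perm indep)) /= big_image.
split=> [[c c0 ->]|[c c0 ->]].
  by exists (fun i => c (g i)) => // i.
exists (fun v => \sum_(i | g i == v) c i) => [v|].
  by apply: sumr_ge0 => i _.
rewrite sumE; apply: eq_bigr => i _; congr (_ *: _).
by rewrite (big_pred1 i) // => j; rewrite (inj_eq gI).
Qed.

(** The criterion through which all Hilbert basis elements below are found: a
    summand of v has its coefficients in [0, 1/m], and once they are known to be
    equal it is an integer multiple of v between 0 and v. *)
Lemma hilbert_step_equal_coefficients (R : realType) (n : nat)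
    (A : set 'rV[int]_n) (g : 'I_n -> 'rV[int]_n) (J : {pred 'I_n}) (m : nat)
    (v : 'rV[int]_n) :
  independent_family R g -> (forall i, A (g i)) -> (0 < m)%N ->
  v *+ m = \sum_(i in J) g i -> (exists l, `|v 0 l| = 1) ->
  (forall (c : 'I_n -> R) (z : 'rV[int]_n),
     (forall i, 0 <= c i <= m%:R^-1) ->
     to_real R z = \sum_(i in J) c i *: to_real R (g i) ->
     exists t, {in J, forall i, c i = t}) ->
  hilbert_step R A v.
Proof.
move=> indep Ag m_gt0 mv [l vl] constJ.
have m_neq0 : m%:R != 0 :> R by rewrite pnatr_eq0 -lt0n.
have sumJ (t : R) :
    \sum_(i in J) t *: to_real R (g i) = (t * m%:R) *: to_real R v.
  by rewrite -scaler_sumr -to_real_sum -mv to_realMn scalerA.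
pose e i : R := if i \in J then m%:R^-1 else 0.
have e0 i : 0 <= e i by rewrite /e; case: ifP; rewrite // invr_ge0.
have vE : to_real R v = \sum_i e i *: to_real R (g i).
  rewrite [RHS](bigID (mem J)) /= [X in _ + X]big1 => [|i /negbTE iJ].
    rewrite addr0 (eq_bigr (fun i => m%:R^-1 *: to_real R (g i))).
      by rewrite sumJ mulVf // scale1r.
    by move=> i iJ; rewrite /e iJ.
  by rewrite /e iJ scale0r.
have [H0 /minimal_hilbert_basis_exists [H minH]] :=
  hilbert_basis_exists R (family_fset g).
exists (family_fset g), H; split=> //; first exact: basis_in_family.
apply: irreducible_in_hilbert_basis (minH.1) _ _ _.
- by apply/eqP => v0; move: vl; rewrite v0 mxE normr0.
- by apply/cone_family => //; exists e.
move=> z1 z2 /(cone_family _ indep)[c1 c1_ge0 z1E].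
move=> /(cone_family _ indep)[c2 c2_ge0 z2E] vz.
have cE i : c1 i + c2 i = e i.
  apply/eqP; rewrite -subr_eq0; apply/eqP; move: i; apply: indep.
  under eq_bigr do rewrite scalerBl scalerDl.
  by rewrite sumrB big_split /= -z1E -z2E -vE -to_realD -vz subrr.
have c1J i : i \notin J -> c1 i = 0.
  move=> /negbTE iJ; have := cE i; rewrite /e iJ.
  by have := c1_ge0 i; have := c2_ge0 i; lra.
have c1_le i : c1 i <= m%:R^-1.
  have [iJ|/c1J->] := boolP (i \in J); last by rewrite invr_ge0.
  by have := cE i; rewrite /e iJ; have := c2_ge0 i; lra.
have z1J : to_real R z1 = \sum_(i in J) c1 i *: to_real R (g i).
  rewrite z1E [LHS](bigID (mem J)) /= [X in _ + X]big1 ?addr0 // => i /c1J->.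
  by rewrite scale0r.
have [|t c1t] := constJ c1 z1 _ z1J; first by move=> i; rewrite c1_ge0 c1_le.
have z1v : to_real R z1 = (t * m%:R) *: to_real R v.
  by rewrite z1J -sumJ; apply: eq_bigr => i /c1t ->.
(* As z1 is integral and v has the coordinate 1 or -1, the factor is an
   integer. *)
have [k kE] : exists k : int, t * m%:R = k%:~R.
  have /(congr1 (fun x : 'rV_n => x 0 l)) := z1v.
  rewrite !mxE => lE; exists (z1 0 l * v 0 l).
  rewrite intrM lE -(mulrA (t * _)) -intrM.
  have -> : v 0 l * v 0 l = 1 by rewrite -expr2 -real_normK ?num_real // vl.
  by rewrite mulr1.
have [j jJ|J0] := pickP (mem J); last first.
  by left; apply: (@to_real_inj R); rewrite z1J to_real0 big_pred0.
have t_ge0 : 0 <= k%:~R :> R by rewrite -kE -(c1t j jJ) mulr_ge0.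
have t_le1 : k%:~R <= 1 :> R.
  by rewrite -kE -(c1t j jJ) -ler_pdivlMr ?ltr0n // mul1r.
move: t_ge0 t_le1; rewrite ler0z (ler_int R k 1) => k_ge0 k_le1.
have [k0|k1] : k = 0 \/ k = 1 by lia.
  by left; apply: (@to_real_inj R); rewrite z1v kE k0 scale0r to_real0.
right; apply: (addrI z1); rewrite -vz addr0.
by apply: (@to_real_inj R); rewrite z1v kE k1 scale1r.
Qed.

(** * Vectors that survive a step *)

Lemma unit_vecE (n : nat) (i l : 'I_n) : unit_vec i 0 l = (l == i)%:R.
Proof. by rewrite mxE eqxx. Qed.

Lemma clique_normalE (n : nat) (K : {set 'I_n}) l :
  clique_normal K 0 l = (l \in K)%:R.
Proof.
rewrite /clique_normal summxE; under eq_bigr do rewrite unit_vecE.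
have [lK|lK] := boolP (l \in K).
  rewrite (bigD1 l) //= eqxx big1 ?addr0 // => i /andP[_ /negbTE].
  by rewrite eq_sym => ->.
by rewrite big1 // => i iK; case: eqP lK => // ->; rewrite iK.
Qed.

(** The case of a single index and m = 1 of the criterion, where equality of
    the coefficients is trivial. *)
Lemma hilbert_step_generator (R : realType) (n : nat) (A : set 'rV[int]_n)
    (g : 'I_n -> 'rV[int]_n) (i : 'I_n) :
  independent_family R g -> (forall j, A (g j)) ->
  (exists l, `|g i 0 l| = 1) -> hilbert_step R A (g i).
Proof.
move=> indep Ag gi.
apply: (hilbert_step_equal_coefficients indep Ag (J := pred1 i) (m := 1)) => //.
  by rewrite mulr1n big_pred1_eq.
by move=> c z _ _; exists (c i) => j /eqP->.
Qed.

Lemma hilbert_step_negative (R : realType) (n : nat) (A : set 'rV[int]_n) :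
  (forall i, A (- unit_vec i)) -> forall i, hilbert_step R A (- unit_vec i).
Proof.
move=> AN i.
apply: (hilbert_step_generator (g := fun j => - unit_vec j)) => //.
  move=> d d0 l; have := congr1 (fun x : 'rV_n => x 0 l) d0.
  rewrite summxE mxE (bigD1 l) //= !mxE !eqxx mulrN1 big1 ?addr0.
    by move/eqP; rewrite oppr_eq0 => /eqP.
  by move=> j /negbTE jl; rewrite !mxE eqxx [l == j]eq_sym jl oppr0 mulr0.
by exists i; rewrite mxE unit_vecE eqxx normrN normr1.
Qed.

Lemma coord_combination (R : realType) (n : nat) (P : pred 'I_n)
    (d : 'I_n -> R) (g : 'I_n -> 'rV[int]_n) l :
  (\sum_(i | P i) d i *: to_real R (g i)) 0 l =
  \sum_(i | P i) d i * (g i 0 l)%:~R.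
Proof. by rewrite summxE; apply: eq_bigr => i _; rewrite !mxE. Qed.

(** For i in K, the vectors e(K) and - e_j, for j distinct from i, form a
    basis. *)
Lemma hilbert_step_clique_normal (R : realType) (n : nat)
    (A : set 'rV[int]_n) (K : {set 'I_n}) :
  (forall i, A (- unit_vec i)) -> (0 < #|K|)%N -> A (clique_normal K) ->
  hilbert_step R A (clique_normal K).
Proof.
move=> AN /card_gt0P[i iK] AK.
pose g j := if j == i then clique_normal K else - unit_vec j.
have gi : g i = clique_normal K by rewrite /g eqxx.
rewrite -gi; apply: hilbert_step_generator.
- move=> d d0.
  have coord l : \sum_j d j * (g j 0 l)%:~R = 0.
    by rewrite -coord_combination d0 mxE.
  have di : d i = 0.
    move: (coord i); rewrite (bigD1 i) //= gi clique_normalE iK mulr1.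
    rewrite big1 ?addr0 // => j /negbTE ji.
    by rewrite /g ji mxE unit_vecE eq_sym ji oppr0 mulr0.
  move=> l; have [->//|li] := eqVneq l i.
  move: (coord l); rewrite (bigD1 l) //= big1 => [|j jl].
    rewrite /g (negbTE li) mxE unit_vecE eqxx addr0 mulrN1.
    by move/eqP; rewrite oppr_eq0 => /eqP.
  have [->|ji] := eqVneq j i; first by rewrite di mul0r.
  by rewrite /g (negbTE ji) mxE unit_vecE eq_sym (negbTE jl) oppr0 mulr0.
- by move=> j; rewrite /g; case: ifP.
- by exists i; rewrite gi clique_normalE iK.
Qed.

(** * Bases carried by a set of vertices *)

Definition extend_negative (n : nat) (K : {set 'I_n}) (h : 'I_n -> 'rV[int]_n)
    (j : 'I_n) : 'rV[int]_n :=
  if j \in K then h j else - unit_vec j.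

(** The coordinates outside K only see the added vectors, whose coefficients
    must therefore vanish; what remains is a relation between the vectors of
    K. *)
Lemma extend_independent (R : realType) (n : nat) (K : {set 'I_n})
    (h : 'I_n -> 'rV[int]_n) :
  (forall j l, j \in K -> l \notin K -> h j 0 l = 0) ->
  (forall d : 'I_n -> R,
     (forall l, l \in K -> \sum_(j in K) d j * (h j 0 l)%:~R = 0) ->
     {in K, forall j, d j = 0}) ->
  independent_family R (extend_negative K h).
Proof.
move=> hK indep d d0.
have coord l : \sum_j d j * (extend_negative K h j 0 l)%:~R = 0.
  by rewrite -coord_combination d0 mxE.
have dN l : l \notin K -> d l = 0.
  move=> lK; move: (coord l); rewrite (bigD1 l) //= big1 => [|j jl].
    rewrite /extend_negative (negbTE lK) mxE unit_vecE eqxx addr0 mulrN1.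
    by move/eqP; rewrite oppr_eq0 => /eqP.
  rewrite /extend_negative; case: ifP => jK; first by rewrite hK // mulr0.
  by rewrite mxE unit_vecE eq_sym (negbTE jl) oppr0 mulr0.
move=> l; have [lK|/dN//] := boolP (l \in K).
apply: indep lK => {}l lK; rewrite -[RHS](coord l) [RHS](bigID (mem K)) /=.
rewrite [X in _ + X]big1 ?addr0 => [|j /dN->]; last by rewrite mul0r.
by apply: eq_bigr => j jK; rewrite /extend_negative jK.
Qed.

(** The criterion of equal coefficients for the basis made of the h j and of the
    - e_l outside K. The h j live on the coordinates of K, so independence and
    integrality are tested there. *)
Lemma hilbert_step_clique_family (R : realType) (n : nat) (A : set 'rV[int]_n)
    (K : {set 'I_n}) (h : 'I_n -> 'rV[int]_n) (m : nat) :
  (0 < #|K|)%N -> (0 < m)%N ->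
  (forall i, A (- unit_vec i)) -> (forall j, j \in K -> A (h j)) ->
  (forall j l, j \in K -> l \notin K -> h j 0 l = 0) ->
  clique_normal K *+ m = \sum_(j in K) h j ->
  (forall d : 'I_n -> R,
     (forall l, l \in K -> \sum_(j in K) d j * (h j 0 l)%:~R = 0) ->
     {in K, forall j, d j = 0}) ->
  (forall (c : 'I_n -> R) (z : 'I_n -> int),
     (forall j, 0 <= c j <= m%:R^-1) ->
     (forall l, l \in K -> \sum_(j in K) c j * (h j 0 l)%:~R = (z l)%:~R) ->
     {in K &, forall i j, c i = c j}) ->
  hilbert_step R A (clique_normal K).
Proof.
move=> /card_gt0P[i iK] m0 AN Ah hK mK indep const.
apply: (hilbert_step_equal_coefficients (extend_independent hK indep)
  (J := mem K) (m := m)) => //.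
- by move=> j; rewrite /extend_negative; case: ifP => // /Ah.
- by rewrite mK; apply: eq_bigr => j jK; rewrite /extend_negative jK.
- by exists i; rewrite clique_normalE iK.
move=> c z cb zE; exists (c i) => j jK.
apply: (const c (z 0)) => // l lK; rewrite -to_realE zE coord_combination.
by apply: eq_bigr => k kK; rewrite /extend_negative kK.
Qed.

(** * Cliques of odd size *)

Lemma iter_next_enum (T : finType) (K : {set T}) x y :
  x \in K -> y \in K -> exists t, iter t (next (enum K)) x = y.
Proof.
move=> xK yK; exists (findex (next (enum K)) x y); apply: iter_findex.
by rewrite (fconnect_cycle (cycle_next (enum_uniq K))) mem_enum.
Qed.

Lemma iter_card_next (T : finType) (K : {set T}) x :
  x \in K -> iter #|K| (next (enum K)) x = x.
Proof.
move=> xK; have cyc := cycle_next (enum_uniq K).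
have xs : x \in enum K by rewrite mem_enum.
rewrite [#|K|]cardE -(order_cycle cyc (enum_uniq K) xs).
exact: (iter_order_cycle cyc).
Qed.

Lemma next_enum_neq (T : finType) (K : {set T}) x :
  (1 < #|K|)%N -> x \in K -> next (enum K) x != x.
Proof.
move=> /card_gt1P[y [z [yK zK yz]]] xK; apply: contraNneq yz => fixx.
have all_x w : w \in K -> w = x.
  by move=> /(iter_next_enum xK)[t <-]; exact: iter_fix.
by rewrite (all_x y) // (all_x z).
Qed.

(** The enumeration of K, closed up by [next], is a Hamiltonian cycle. The
    coefficients of a relation between its edges change sign from one edge to
    the next, so on an odd cycle they vanish; integrality forces the
    coefficients of a summand to be constant along it. *)
Lemma hilbert_step_odd_clique (R : realType) (n : nat) (A : set 'rV[int]_n)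
    (K : {set 'I_n}) :
  (forall i, A (- unit_vec i)) ->
  {in K &, forall i j, i != j -> A (unit_vec i + unit_vec j)} ->
  (1 < #|K|)%N -> odd #|K| -> hilbert_step R A (clique_normal K).
Proof.
move=> AN AE K_gt1 K_odd.
pose nx := next (enum K).
have nxK j : (nx j \in K) = (j \in K).
  by rewrite -mem_enum mem_next mem_enum.
have nx_inj : injective nx := can_inj (prev_next (enum_uniq K)).
pose h j : 'rV[int]_n := unit_vec j + unit_vec (nx j).
(* The edges of the cycle at [nx j] are the ones indexed by [nx j] and [j]. *)
have sumE (c : 'I_n -> R) j : j \in K ->
    \sum_(i in K) c i * (h i 0 (nx j))%:~R = c (nx j) + c j.
  move=> jK; under eq_bigr do rewrite mxE !unit_vecE intrD mulrDr.
  rewrite big_split /=; congr (_ + _).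
    rewrite (bigD1 (nx j)) ?nxK //= eqxx mulr1 big1 ?addr0 // => i /andP[_].
    by rewrite eq_sym => /negbTE->; rewrite mulr0.
  rewrite (bigD1 j) //= eqxx mulr1 big1 ?addr0 // => i /andP[_].
  by rewrite (inj_eq nx_inj) eq_sym => /negbTE->; rewrite mulr0.
have onto l : l \in K -> exists2 j, j \in K & l = nx j.
  move=> lK; exists (prev (enum K) l); last by rewrite /nx next_prev ?enum_uniq.
  by rewrite -mem_enum mem_prev mem_enum.
have hK j l : j \in K -> l \notin K -> h j 0 l = 0.
  move=> jK lK; rewrite mxE !unit_vecE.
  case: eqP lK => [->|_]; rewrite ?jK //.
  by case: eqP => [->|]; rewrite ?nxK ?jK.
apply: (hilbert_step_clique_family (h := h) (m := 2)) => //.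
- exact: ltnW.
- by move=> j jK; apply: AE; rewrite ?nxK // eq_sym; exact: next_enum_neq.
- apply: (@to_real_inj R); rewrite to_realMn to_real_sum; apply/rowP => l.
  rewrite mxE to_realE clique_normalE.
  transitivity (\sum_(i in K) 1 * (h i 0 l)%:~R : R); last first.
    by rewrite summxE; apply: eq_bigr => i _; rewrite mul1r to_realE.
  have [/onto[j jK ->]|lK] := boolP (l \in K).
    by rewrite (sumE (fun=> 1)) // mulr1.
  by rewrite big1 ?mulr0 // => i iK; rewrite hK // mulr0.
- move=> d d0 j jK.
  have dnx i : i \in K -> d (nx i) = - d i.
    by move=> iK; have := d0 (nx i); rewrite nxK sumE // => /(_ iK) ?; lra.
  have diter t : iter t nx j \in K /\ d (iter t nx j) = (-1) ^+ t * d j.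
    elim: t => [|t [tK IH]]; first by rewrite mul1r.
    by rewrite iterS nxK dnx // IH exprS mulN1r mulNr.
  have [_] := diter #|K|; rewrite /nx iter_card_next // -signr_odd K_odd.
  by rewrite expr1 mulN1r => ?; lra.
- move=> c z cb zE i j iK jK.
  have cnx l : l \in K -> c (nx l) = c l.
    move=> lK; have := zE (nx l); rewrite nxK sumE // => /(_ lK).
    have /andP[? ?] := cb l; have /andP[? ?] := cb (nx l) => zl.
    have : 0 <= (z (nx l))%:~R :> R by lra.
    have : (z (nx l))%:~R <= 1 :> R by lra.
    rewrite ler0z (ler_int R _ 1) => z1 z0.
    (* The two coefficients are at most 1/2, so a sum 0 makes both 0 and a sum
       1 makes both 1/2. *)
    have [z_eq|z_eq] : z (nx l) = 0 \/ z (nx l) = 1 by lia.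
      by move: zl; rewrite z_eq; lra.
    by move: zl; rewrite z_eq; lra.
  have [t <-] := iter_next_enum iK jK.
  suff [] : iter t nx i \in K /\ c (iter t nx i) = c i by [].
  by elim: t => [//|t [tK IH]]; rewrite iterS nxK cnx.
Qed.

(** * Cliques obtained by deleting one vertex *)

(** The coordinate l of a combination is the sum of all coefficients minus the
    one of index l: a relation has equal coefficients d with (k - 1) d = 0, and
    coefficients of an integer point differ by integers. These differences
    vanish because 1/(k - 1) < 1, which is where k > 2 is used. *)
Lemma hilbert_step_delete_vertex (R : realType) (n : nat) (A : set 'rV[int]_n)
    (K : {set 'I_n}) :
  (forall i, A (- unit_vec i)) ->
  {in K, forall i, A (clique_normal (K :\ i)%SET)} ->
  (2 < #|K|)%N -> hilbert_step R A (clique_normal K).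
Proof.
move=> AN AK K_gt2.
pose h j := clique_normal (K :\ j)%SET.
have sumE (c : 'I_n -> R) l : l \in K ->
    \sum_(i in K) c i * (h i 0 l)%:~R = \sum_(i in K) c i - c l.
  move=> lK; rewrite (bigD1 l) //= [in RHS](bigD1 l) //=.
  rewrite clique_normalE in_setD1 eqxx mulr0 add0r [RHS]addrC addKr.
  apply: eq_bigr => i /andP[_ il].
  by rewrite clique_normalE in_setD1 eq_sym il lK mulr1.
have hK j l : j \in K -> l \notin K -> h j 0 l = 0.
  by move=> jK lK; rewrite clique_normalE in_setD1 (negbTE lK) andbF.
apply: (hilbert_step_clique_family (h := h) (m := #|K|.-1)) => //.
- exact: ltn_trans K_gt2.
- by rewrite -ltnS prednK; [exact: ltnW | exact: ltn_trans K_gt2].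
- apply: (@to_real_inj R); rewrite to_realMn to_real_sum; apply/rowP => l.
  rewrite mxE to_realE clique_normalE.
  transitivity (\sum_(i in K) 1 * (h i 0 l)%:~R : R); last first.
    by rewrite summxE; apply: eq_bigr => i _; rewrite mul1r to_realE.
  have [lK|lK] := boolP (l \in K).
    rewrite (sumE (fun=> 1)) // mulr1 sumr_const.
    rewrite -[in RHS](prednK (ltnW (ltnW K_gt2))).
    by rewrite -[in RHS]natr1 addrK.
  by rewrite big1 ?mulr0 // => i iK; rewrite hK // mulr0.
- move=> d d0; set s := \sum_(i in K) d i.
  have ds i : i \in K -> d i = s.
    by move=> iK; have := d0 i iK; rewrite sumE // -/s => ?; lra.
  have sE : s = s *+ #|K| by rewrite -sumr_const; exact: eq_bigr.
  have s0 : s = 0.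
    apply/eqP; have : s *+ #|K|.-1 == 0.
      rewrite -(inj_eq (addrI s)) addr0 -mulrS prednK -?sE //.
      exact: ltn_trans K_gt2.
    by rewrite mulrn_eq0 => /orP[|//]; lia.
  by move=> j /ds->.
- move=> c z cb zE i j iK jK.
  have := zE i iK; have := zE j jK; rewrite !sumE // => zj zi.
  have dz : (z i - z j)%:~R = c j - c i by rewrite intrB -zi -zj; lra.
  have m_lt1 : (#|K|.-1)%:R^-1 < 1 :> R.
    by rewrite invf_lt1 ?ltr0n ?ltr1n; lia.
  have /andP[? ?] := cb i; have /andP[? ?] := cb j.
  have : (z i - z j)%:~R < 1 :> R by rewrite dz; lra.
  have : (-1)%:~R < (z i - z j)%:~R :> R by rewrite dz; lra.
  rewrite (ltr_int R _ 1) ltr_int => lo hi.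
  have z0 : z i - z j = 0 by lia.
  by move: dz; rewrite z0; lra.
Qed.

(** * The theorem *)

Theorem corollary4p12 (R : realType) (n : nat) (E : rel 'I_n)
    (E_simple : simple_graph E) (K : {set 'I_n})
    (K_clique : clique E K) (K_ge2 : (2 <= #|K|)%N) :
  hilbert_closure R E 2 (clique_normal K).
Proof.
have N0 i : graph_vectors E (- unit_vec i) by right; exists i.
have N1 := @hilbert_step_negative R n _ N0.
have odd_case (L : {set 'I_n}) : L \subset K -> (1 < #|L|)%N -> odd #|L| ->
    hilbert_step R (graph_vectors E) (clique_normal L).
  move=> /fintype.subsetP LK; apply: hilbert_step_odd_clique => // i j iL jL ij.
  by left; exists i, j; split=> //; apply: K_clique => //; exact: LK.
have keep A : (forall i, A (- unit_vec i)) -> A (clique_normal K) ->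
    hilbert_step R A (clique_normal K).
  by move=> AN; apply: hilbert_step_clique_normal => //; exact: ltnW.
rewrite /hilbert_closure /=.
have [K_odd|K_even] := boolP (odd #|K|).
  by apply: (keep _ N1); exact: odd_case.
have [K_gt2|K_le2] := ltnP 2 #|K|.
  apply: hilbert_step_delete_vertex => // i iK.
  have cardKi := cardsD1 i K; rewrite iK in cardKi.
  by apply: odd_case; [exact: subD1set | lia | lia].
have /cards2P[i [j [ij KE]]] : #|K| == 2 by rewrite eqn_leq K_le2.
have K0 : graph_vectors E (clique_normal K); last first.
  exact: (keep _ N1 (keep _ N0 K0)).
left; exists i, j.
have [iK jK] : i \in K /\ j \in K by rewrite KE !inE !eqxx orbT.
split; first exact: K_clique.
by rewrite /clique_normal KE big_setU1 ?inE //= big_set1.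
Qed.
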